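(* The following properties are satisfied: (i) For $2\le k\le n$ the symmetric partition lattice $J_k^n$ has order $k$; and for $n\ge3$, $\lceil n/2\rceil\le S\le n-1$, the symmetric partition lattice $J_{3,S}^n$ has order $3$. (ii) Let $n\geq4$, $\lceil n/2\rceil\le S\le n-1$, let $P\in\mathcal{M}(\mathbb{X}_n)$ be a probability measure, and let $F\subseteq\{1,\dots,n\}$ with $|F|=n-1$. Then $(J_{3,S}^n[P])_F=J_{3,S-1}^{n-1}[P_F]$ if $2S>n$, and $(J_{3,S}^n[P])_F=J_{3,S}^{n-1}[P_F]$ if $2S=n$. For $n=3$ and any probability measure $P\in\mathcal{M}(\mathbb{X}_3)$, the marginals $(J_{3,2}^3[P])_F$, $\emptyset\ne F\subsetneq\{1,2,3\}$, are zero.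
   Context: $\Pi_n$ denotes the set of all partitions of $\{1,\dots,n\}$ into nonempty disjoint blocks, ordered by refinement: $\pi\le\sigma$ iff every block of $\pi$ is contained in a block of $\sigma$; $|\pi|$ is the number of blocks; $\hat{\mathbf{0}}_n$ is the partition into singletons and $\hat{\mathbf{1}}_n$ the one-block partition. A lower set of $\Pi_n$ is a subset $T$ containing $\hat{\mathbf 0}_n$ and $\hat{\mathbf 1}_n$ such that $w\in T\setminus\{\hat{\mathbf 1}_n\}$, $z\le w$ imply $z\in T$. A symmetric partition lattice is a lower set $T\subseteq\Pi_n$ invariant under all permutations of $\{1,\dots,n\}$ (acting on blocks); its order is $1+\max$ of the largest block size of $\pi$ over all $\pi\in T\setminus\{\hat{\mathbf 1}_n\}$. For $2\le k\le n$, $J_k^n:=\{\pi\in\Pi_n:\text{every block of }\pi\text{ has at most }k-1\text{ elements}\}\cup\{\hat{\mathbf{1}}_n\}$. For $\lceil n/2\rceil\le S\le n-1$, $J_{3,S}^n:=\{\pi\in\Pi_n:\text{every block of }\pi\text{ has at most 2 elements and }|\pi|\geq S\}\cup\{\hat{\mathbf{1}}_n\}$. For a lower set $T\subseteq\Pi_n$ with the induced order, its M\''obius function is $\mu(x,x)=1$, $\mu(x,y)=-\sum_{z\in T,\,x\le z<y}\mu(x,z)$ for $x<y$ in $T$, $0$ otherwise. $X_1,\dots,X_n$ are nonempty sets, $\mathbb{X}_n=X_1\times\cdots\times X_n$, and $\mathcal{M}(\mathbb{X}_n)$ is the vector space of discrete signed measures on $\mathbb{X}_n$ (finite real linear combinations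 of Dirac measures). For $\eta\in\mathcal{M}(\mathbb{X}_n)$ and nonempty $F\subseteq\{1,\dots,n\}$, $\eta_F$ is the marginal of $\eta$ on $\prod_{i\in F}X_i$; for a probability $P$ and $\pi=(F_1,\dots,F_\ell)\in\Pi_n$, $P_\pi:=P_{F_1}\times\cdots\times P_{F_\ell}$, viewed as a measure on $\mathbb{X}_n$; and $T[P]:=\sum_{\pi\in T}\mu(\pi,\hat{\mathbf{1}}_n)P_\pi$. For $|F|=n-1$, $J_{3,S'}^{n-1}[P_F]$ is the interaction of the probability measure $P_F$ on the $n-1$ coordinates indexed by $F$ (relabelled as $\{1,\dots,n-1\}$). *)

(* Defs.v *)
From mathcomp Require Import all_boot all_order all_fingroup all_algebra.

Set Implicit Arguments.
Unset Strict Implicit.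
Unset Printing Implicit Defensive.

Import GRing.Theory.

(* Partitions are taken over an arbitrary finite index type I; the lattice
   Pi_n is Partitions 'I_n. *)
Section PartitionLattices.
Variable I : finType.
Implicit Types (x y z pi sigma : {set {set I}}) (T : {set {set {set I}}}).

Definition Partitions : {set {set {set I}}} :=
  [set pi | partition pi [set: I]].

Definition refines pi sigma : bool :=
  [forall B in pi, exists C in sigma, B \subset C].

Definition strictly_refines pi sigma : bool :=
  refines pi sigma && (pi != sigma).

Definition discrete_partition : {set {set I}} := [set [set i] | i : I].

(* The one-block partition, for nonempty I. *)
Definition one_block : {set {set I}} := [set [set: I]].

Definition lower_set T : Prop :=
  [/\ T \subset Partitions,
      discrete_partition \in T,
      one_block \in T &
      forall w z, w \in T -> w != one_block -> z \in Partitions ->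
        refines z w -> z \in T].

Definition permute_partition (s : {perm I}) pi : {set {set I}} :=
  [set [set s i | i in B] | B : {set I} in pi].

Definition symmetric_partition_lattice T : Prop :=
  lower_set T /\
  forall s : {perm I}, [set permute_partition s pi | pi in T] = T.

Definition lattice_order T : nat :=
  (\max_(pi in T :\ one_block) \max_(B in pi) #|B|).+1.

(* The Moebius function of T with the induced order. The first argument of
   mobius_rec only bounds the depth of the recursion; #|T| is enough, as the
   lemma mobiusE below shows. *)
Fixpoint mobius_rec (m : nat) T x y : int :=
  if (x \notin T) || (y \notin T) then 0%R
  else if x == y then 1%R
  else if m is m'.+1 then
    if refines x y then
      (- \sum_(z in T | refines x z && strictly_refines z y)
           mobius_rec m' T x z)%R
    else 0%R
  else 0%R.

Definition mobius T x y : int := mobius_rec #|T| T x y.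

End PartitionLattices.

Arguments one_block {I}.
Arguments discrete_partition {I}.

Lemma refines_trans (I : finType) : transitive (@refines I).
Proof.
move=> y x z /forall_inP xy /forall_inP yz; apply/forall_inP => B /xy.
case/exists_inP => C /yz /exists_inP[D Dz CD] BC.
by apply/exists_inP; exists D => //; apply: subset_trans CD.
Qed.

Lemma refines_sub (I : finType) (x y : {set {set I}}) :
  x \in Partitions I -> refines x y -> refines y x -> x \subset y.
Proof.
rewrite inE => /and3P[_ tx x0] /forall_inP xy /forall_inP yx.
apply/subsetP => B Bx; have /exists_inP[C Cy BC] := xy _ Bx.
have /exists_inP[D Dx CD] := yx _ Cy.
have eBD : B = D.
  apply/eqP; apply: contraT => nBD.
  have /pred0P d := trivIsetP tx _ _ Bx Dx nBD.
  have /set0Pn[i iB] : B != set0 by apply: contraNneq x0 => <-.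
  have := d i; rewrite /= iB /=.
  by rewrite (subsetP CD) // (subsetP BC).
suff -> : B = C by [].
by apply/eqP; rewrite eqEsubset BC eBD CD.
Qed.

Lemma refines_anti (I : finType) (x y : {set {set I}}) :
  x \in Partitions I -> y \in Partitions I ->
  refines x y -> refines y x -> x = y.
Proof.
by move=> xP yP xy yx; apply/eqP; rewrite eqEsubset !refines_sub.
Qed.

Lemma mobius_rec_stable (I : finType) (T : {set {set {set I}}}) x y m :
  T \subset Partitions I ->
  #|[set z in T | strictly_refines z y]| <= m ->
  mobius_rec m T x y = mobius_rec m.+1 T x y.
Proof.
move=> /subsetP TP; elim: m y => [|m IH] y; first last.
  move=> le_m.
  rewrite [LHS]/= [RHS](_ : _ =
    if (x \notin T) || (y \notin T) then 0%R
    else if x == y then 1%R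
    else if refines x y then
      (- \sum_(z in T | refines x z && strictly_refines z y)
           mobius_rec m.+1 T x z)%R
    else 0%R) //.
  case: ifP => // /negbT; rewrite negb_or !negbK => /andP[_ yT].
  case: ifP => // _; case: ifP => // _; congr (- _)%R.
  apply: eq_bigr => z /and3P[zT _ zy]; apply: IH.
  rewrite -ltnS; apply: leq_trans le_m; apply: proper_card.
  apply/properP; split; last first.
    by exists z; rewrite inE zT //= /strictly_refines eqxx andbF.
  apply/subsetP => w; rewrite !inE => /andP[-> /andP[wz nwz]] /=.
  case/andP: zy => zy nzy; rewrite /strictly_refines (refines_trans wz zy) /=.
  apply: contraNneq nzy => ewy; apply/eqP/refines_anti; rewrite ?TP //.
  by rewrite -ewy.
rewrite leqn0 cards_eq0 => /eqP s0 /=.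
case: ifP => // _; case: ifP => // _; case: ifP => // _.
rewrite big_pred0 ?oppr0 // => z; apply/negbTE/negP => /and3P[zT _ zy].
by move/setP/(_ z): s0; rewrite !inE zT zy.
Qed.

Lemma mobiusE (I : finType) (T : {set {set {set I}}}) :
  T \subset Partitions I ->
  {in T &, forall x y,
    mobius T x y =
      if x == y then 1%R
      else if refines x y then
        (- \sum_(z in T | refines x z && strictly_refines z y)
             mobius T x z)%R
      else 0%R}.
Proof.
move=> TP x y xT yT; rewrite /mobius mobius_rec_stable //.
  by rewrite [LHS]/= xT yT.
by apply: subset_leq_card; apply/subsetP => z; rewrite inE => /andP[].
Qed.

Definition J (k n : nat) : {set {set {set 'I_n}}} :=
  [set pi in Partitions 'I_n | [forall B in pi, #|B| <= k.-1]]
    :|: [set one_block].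

Definition J3 (S n : nat) : {set {set {set 'I_n}}} :=
  [set pi in Partitions 'I_n |
     [forall B in pi, #|B| <= 2] && (S <= #|pi|)]
    :|: [set one_block].

From mathcomp Require Import boolp classical_sets functions fsbigop reals.
From mathcomp Require Import numfun.

Local Open Scope ring_scope.

(* Measures are set functions defined on all subsets. *)
Section Measures.
Variable R : realType.

Definition discrete_signed_measure (T : Type) (eta : set T -> R) : Prop :=
  exists s : seq (R * T), forall A, eta A = \sum_(p <- s) p.1 * \1_A p.2.

Definition discrete_probability (T : Type) (P : set T -> R) : Prop :=
  [/\ discrete_signed_measure P, forall A, 0 <= P A & P classical_sets.setT = 1].

(* The image of eta under x |-> x \o f. *)
Definition reindex_measure (I J : finType) (X : I -> pointedType) (f : J -> I)
    (eta : set (forall i, X i) -> R) : set (forall j, X (f j)) -> R :=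
  fun A => eta [set x : forall i, X i | A (fun j => x (f j))]%classic.
Arguments reindex_measure {I J X} f eta _.

Definition marginal (I : finType) (X : I -> pointedType) (F : {set I})
    (eta : set (forall i, X i) -> R) :
    set (forall j : {i | i \in F}, X (val j)) -> R :=
  reindex_measure val eta.
Arguments marginal {I X} F eta _.

(* P_pi, given by its point masses: the mass of {x} is the product over the
   blocks B of P_B({x_B}). For a discrete P only finitely many are nonzero. *)
Definition partition_product (I : finType) (X : I -> pointedType)
    (P : set (forall i, X i) -> R) (pi : {set {set I}}) :
    set (forall i, X i) -> R :=
  fun A => \sum_(x \in A)
    \prod_(B in pi)
      marginal B P [set (fun j : {i | i \in B} => x (val j))]%classic.

Definition interaction (I : finType) (X : I -> pointedType)
    (T : {set {set {set I}}}) (P : set (forall i, X i) -> R) :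
    set (forall i, X i) -> R :=
  fun A => \sum_(pi in T) (mobius T pi one_block)%:~R *
    partition_product P pi A.

End Measures.

Arguments reindex_measure {R I J X} f eta _.
Arguments marginal {R I X} F eta _.
Arguments partition_product {R I X} P pi _.
Arguments interaction {R I X} T P _.

(* Main.v *)
Require Import Defs.
From mathcomp Require Import all_boot all_order all_fingroup all_algebra.
From mathcomp Require Import zify.

Set Implicit Arguments.
Unset Strict Implicit.
Unset Printing Implicit Defensive.
Import GRing.Theory.

(** Part (i) is uniform: [J k n] and [J3 S n] are both obtained by bounding
    the block sizes by [b] and the number of blocks from below by [S], and
    adjoining the top. Refining a partition shrinks blocks and creates more of
    them, so this is a lower set; the largest block size [b] is attained by one
    block of size [b] together with singletons.

    Part (ii) is a Galois connection argument. Let [f : J -> I] be the inclusion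
    of the remaining coordinates. A partition [pi] of [I] has a restriction to
    [J], and a partition [sigma] of [J] has an extension to [I] by singletons;
    the extension of [sigma] refines [pi] exactly when [sigma] refines the
    restriction of [pi] ([extension_refines]). The marginal of [P_pi] is
    [(P_J)_rho], with [rho] the restriction of [pi]
    ([reindex_partition_product]), so in the marginal of [T[P]] the coefficient
    of [(P_J)_rho] is the sum of [mu_T(pi, 1)] over all [pi] in [T] restricting
    to [rho]. Summing these coefficients over all [rho] above [sigma] gives, by
    the connection, the sum of [mu_T(pi, 1)] over all [pi] above the extension
    of [sigma]. If that extension lies in [T], the sum is 1 if it is the top of
    [T] and 0 otherwise ([mobius_sum_dual], [fiber_mobius_sum_extension]).

    - When one of [n >= 4] coordinates is removed and [T] is [J3 S n], the
      extension of every partition other than the top of [J3 S.-1 n.-1] lies in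
      [T] and is not its top, while only the top of [T] restricts to the top of
      [J3 S.-1 n.-1]. So the coefficients satisfy the equations characterising
      the Moebius function of [J3 S.-1 n.-1]. If [2 * S = n], then
      [J3 S.-1 n.-1 = J3 S n.-1], because [n.-1] points in blocks of size at
      most two already need [S] blocks.
    - For [n = 3] the extension of every partition of a proper nonempty subset
      lies in [J3 2 3] and is not the top, so all coefficients are zero.

    For the marginal of [P_pi], write [P] as a mixture of point masses at points
    [p_k]. Then [P_pi] is the law of the point obtained by choosing, for each
    block, an index [k] independently and copying [p_k] on that block. Choosing
    the indices for the labels [l] of any labelling of [I] whose fibres are the
    blocks gives the same law ([partition_product_atomic]), and in this form
    restricting to [J] means restricting the labelling. *)

(** * Partitions ordered by refinement *)

Section Partition.
Variable I : finType.
Implicit Types (x y z pi sigma : {set {set I}}) (T : {set {set {set I}}}).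

Lemma PartitionsP pi :
  reflect [/\ forall i, exists2 B, B \in pi & i \in B,
              forall B C i, B \in pi -> C \in pi -> i \in B -> i \in C -> B = C
            & forall B, B \in pi -> exists i, i \in B]
          (pi \in Partitions I).
Proof.
rewrite inE; apply: (iffP and3P) => [[/eqP cov tr n0]|[cov tr n0]].
  split=> [i|B C i Bpi Cpi iB iC|B Bpi].
  - have : i \in cover pi by rewrite cov inE.
    by case/bigcupP => B; exists B.
  - by rewrite -(def_pblock tr Bpi iB) (def_pblock tr Cpi iC).
  - by apply/set0Pn; apply: contraNneq n0 => <-.
split.
- rewrite eqEsubset subsetT; apply/subsetP => i _.
  by have [B Bpi iB] := cov i; apply/bigcupP; exists B.
- apply/trivIsetP => B C Bpi Cpi; apply: contraNT => /pred0Pn[i /andP[iB iC]].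
  by apply/eqP/(tr B C i).
- by apply/negP => /n0[i]; rewrite inE.
Qed.

Lemma refinesP x y :
  reflect (forall B, B \in x -> exists2 C, C \in y & B \subset C) (refines x y).
Proof.
by apply: (iffP forall_inP) => h B /h;
  [move/exists_inP | move=> ?; apply/exists_inP].
Qed.

Lemma refines_refl x : refines x x.
Proof. by apply/refinesP => B; exists B. Qed.

Lemma refines_one_block x : refines x one_block.
Proof. by apply/refinesP => B _; exists [set: I]; rewrite ?inE ?subsetT. Qed.

(** Distinct blocks of the coarser partition contain distinct blocks of the
    finer one, so sending a block of [x] to the block of [y] containing it is
    onto. *)
Lemma card_refines x y :
  x \in Partitions I -> y \in Partitions I -> refines x y -> #|y| <= #|x|.
Proof.
move=> /PartitionsP[covx _ _] /PartitionsP[_ try n0y] /refinesP xy.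
pose g (B : {set I}) := odflt set0 [pick C in y | B \subset C].
apply: leq_trans (leq_imset_card g (mem x)).
apply/subset_leq_card/subsetP => C Cy.
have [i iC] := n0y C Cy; have [B Bx iB] := covx i.
apply/imsetP; exists B => //; rewrite /g; case: pickP => [D /andP[Dy BD]|] /=.
  by apply: (try C D i) => //; apply: (subsetP BD).
have [D Dy BD] := xy B Bx.
by move/(_ D); rewrite Dy BD.
Qed.

Lemma one_block_Partitions : 0 < #|I| -> one_block \in Partitions I.
Proof.
move=> /card_gt0P[i0 _]; apply/PartitionsP; split=> [i|B C i|B].
- by exists [set: I]; rewrite ?inE.
- by rewrite !inE => /eqP-> /eqP->.
- by rewrite inE => /eqP->; exists i0; rewrite inE.
Qed.

Lemma discrete_Partitions : discrete_partition \in Partitions I.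
Proof.
apply/PartitionsP; split=> [i|B C i|B].
- by exists [set i]; rewrite ?inE ?eqxx //; apply: imset_f.
- by move=> /imsetP[a _ ->] /imsetP[b _ ->]; rewrite !inE => /eqP-> /eqP->.
- by move=> /imsetP[a _ ->]; exists a; rewrite inE.
Qed.

Lemma one_block_refines pi :
  pi \in Partitions I -> 0 < #|I| -> refines one_block pi -> pi = one_block.
Proof.
move=> piP I0 le; apply: refines_anti => //; first exact: one_block_Partitions.
exact: refines_one_block.
Qed.

End Partition.

(** * The Moebius function as a two-sided inverse *)

Section Mobius.
Variables (I : finType) (T : {set {set {set I}}}).
Hypothesis TP : T \subset Partitions I.
Implicit Types x y z : {set {set I}}.

Lemma mobius_nrefines x y :
  x \in T -> y \in T -> ~~ refines x y -> mobius T x y = 0%R.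
Proof.
move=> xT yT nxy; rewrite mobiusE // (negPf nxy); case: eqP nxy => // ->.
by rewrite refines_refl.
Qed.

Lemma mobius_sum x y : x \in T -> y \in T ->
  (\sum_(z in T) mobius T x z * (refines z y)%:R = (x == y)%:R)%R.
Proof.
move=> xT yT; rewrite (bigID (fun z => refines x z && refines z y)) /=.
rewrite addrC big1 ?add0r => [|z /andP[zT]]; last first.
  rewrite negb_and => /orP[nxz|/negPf->]; last by rewrite mulr0.
  by rewrite mobius_nrefines ?mul0r.
rewrite (eq_bigr (fun z => mobius T x z)) => [|z /and3P[_ _ ->]];
  last by rewrite mulr1.
have anti z : z \in T -> refines x z -> refines z x -> z = x.
  by move=> zT xz zx; apply: refines_anti => //; apply: (subsetP TP).
case: (eqVneq x y) => [<-|nxy].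
  rewrite (big_pred1 x) ?mobiusE ?eqxx // => z /=.
  apply/and3P/eqP => [[zT xz zx]|->]; last by rewrite refines_refl.
  exact: anti.
have [xy|nxy'] := boolP (refines x y); last first.
  rewrite big_pred0 // => z; apply/negP => /and3P[_ xz zy].
  by rewrite (refines_trans xz zy) in nxy'.
rewrite (bigD1 y) /=; last by rewrite yT xy refines_refl.
rewrite mobiusE // (negPf nxy) xy; apply/eqP; rewrite addrC subr_eq0; apply/eqP.
by apply: eq_bigl => z; rewrite /strictly_refines -!andbA.
Qed.

(** The Moebius function is defined by recursion on its second argument, hence
    is a left inverse of the zeta matrix of [T]; a left inverse of a square
    matrix is also a right inverse, which gives the recursion on the first
    argument. *)
Lemma mobius_sum_dual x y : x \in T -> y \in T ->
  (\sum_(z in T | refines x z) mobius T z y = (x == y)%:R)%R.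
Proof.
move=> xT yT.
pose M := (\matrix_(i < #|T|, j < #|T|) mobius T (enum_val i) (enum_val j))%R.
pose Z := (\matrix_(i < #|T|, j < #|T|)
             ((refines (enum_val i) (enum_val j))%:R : int))%R.
have MZ : (M *m Z = 1%:M)%R.
  apply/matrixP => i j; rewrite !mxE -(inj_eq enum_val_inj).
  rewrite -mobius_sum ?enum_valP // [RHS]big_enum_val; apply: eq_bigr => k _.
  by rewrite !mxE.
have /matrixP/(_ (enum_rank_in xT x) (enum_rank_in yT y)) := mulmx1C MZ.
rewrite !mxE -(inj_eq enum_val_inj) !enum_rankK_in // => <-.
rewrite [LHS]big_mkcondr /= [LHS]big_enum_val; apply: eq_bigr => k _.
by rewrite !mxE !enum_rankK_in //; case: ifP => _; rewrite ?mul1r ?mul0r.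
Qed.

Lemma mobius_inversion (c : {set {set I}} -> int) x : x \in T ->
  (c x = \sum_(z in T) mobius T x z * \sum_(w in T | refines z w) c w)%R.
Proof.
move=> xT.
under eq_bigr do rewrite big_mkcondr mulr_sumr /=.
rewrite exchange_big /= (bigD1 x) //= [X in (_ + X)%R]big1 ?addr0 => [|w].
  have := mobius_sum xT xT; rewrite eqxx => e.
  rewrite -[LHS]mul1r -[X in (X * _)%R]/(true%:R)%R -e mulr_suml.
  by apply: eq_bigr => z _; case: ifP; rewrite ?mulr1 ?mulr0 ?mul0r.
case/andP=> wT nwx; have := mobius_sum xT wT; rewrite eq_sym (negPf nwx) => e.
rewrite -[RHS](mul0r (c w)) -[X in (X * _)%R]/(false%:R)%R -e mulr_suml.
by apply: eq_bigr => z _; case: ifP; rewrite ?mulr1 ?mulr0 ?mul0r.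
Qed.

End Mobius.

(** * Restriction and extension of partitions *)

Section Restriction.
Variables (I J : finType) (f : J -> I).
Hypothesis f_inj : injective f.
Implicit Types (pi : {set {set I}}) (sigma rho : {set {set J}}).

Definition restriction pi : {set {set J}} :=
  [set f @^-1: B | B : {set I} in pi] :\ set0.

Definition extension sigma : {set {set I}} :=
  [set f @: (B : {set J}) | B in sigma] :|:
  [set [set i] | i in ~: [set f j | j : J]].

Lemma in_restriction pi (B : {set J}) : reflect
  (exists C, [/\ C \in pi, B = f @^-1: C & exists j, j \in B])
  (B \in restriction pi).
Proof.
rewrite /restriction !inE.
apply: (iffP andP) => [[/set0Pn B0 /imsetP[C Cpi eB]]|[C [Cpi eB B0]]].
  by exists C.
by split; [apply/set0Pn | rewrite eB imset_f].
Qed.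

Lemma in_extension sigma (B : {set I}) : reflect
  ((exists2 C, C \in sigma & B = f @: C) \/
   (exists2 i, (forall j, f j != i) & B = [set i])) (B \in extension sigma).
Proof.
rewrite /extension !inE; apply: (iffP orP) => -[].
- by case/imsetP => C ? ->; left; exists C.
- case/imsetP => i; rewrite inE => ni ->; right; exists i => // j.
  by apply: contraNneq ni => <-; rewrite imset_f.
- by case=> C ? ->; left; rewrite imset_f.
- case=> i ni ->; right; rewrite imset_f // inE; apply/negP => /imsetP[j _ e].
  by have := ni j; rewrite e eqxx.
Qed.

Lemma restriction_Partitions pi :
  pi \in Partitions I -> restriction pi \in Partitions J.
Proof.
case/PartitionsP => cov tr _; apply/PartitionsP; split=> [j|B C j|B].
- have [B Bpi jB] := cov (f j); exists (f @^-1: B); last by rewrite inE.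
  by apply/in_restriction; exists B; split=> //; exists j; rewrite inE.
- move=> /in_restriction[B' [B'pi -> _]] /in_restriction[C' [C'pi -> _]].
  rewrite !inE => jB jC.
  by rewrite (tr B' C' (f j)).
- by case/in_restriction => C [].
Qed.

Lemma extension_Partitions sigma :
  sigma \in Partitions J -> extension sigma \in Partitions I.
Proof.
case/PartitionsP => cov tr n0; apply/PartitionsP; split=> [i|B C i|B].
- case: (pickP (fun j => f j == i)) => [j /eqP <-|nj].
    have [B Bs jB] := cov j; exists (f @: B); last by rewrite imset_f.
    by apply/in_extension; left; exists B.
  exists [set i]; last by rewrite inE.
  by apply/in_extension; right; exists i => // j; rewrite nj.
- move=> /in_extension[] [B' hB ->] /in_extension[] [C' hC ->].
  + case/imsetP=> j jB -> /imsetP[k kC /f_inj ejk].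
    by rewrite (tr B' C' j) // ejk.
  + by case/imsetP=> j jB -> ; rewrite inE => /eqP e; have := hC j; rewrite e eqxx.
  + by rewrite inE => /eqP-> /imsetP[j _ e]; have := hB j; rewrite e eqxx.
  + by rewrite !inE => /eqP<- /eqP<-.
- case/in_extension => [[C /n0[j jC] ->]|[i _ ->]];
    last by exists i; rewrite inE.
  by exists (f j); rewrite imset_f.
Qed.

(** The Galois connection: extension is left adjoint to restriction. *)
Lemma extension_refines sigma pi :
  sigma \in Partitions J -> pi \in Partitions I ->
  refines (extension sigma) pi = refines sigma (restriction pi).
Proof.
case/PartitionsP => _ _ n0 /PartitionsP[cov _ _].
apply/refinesP/refinesP => h B.
  move=> Bs; have [|C Cpi] := h (f @: B).
    by apply/in_extension; left; exists B.
  rewrite sub_imset_pre => BC; exists (f @^-1: C) => //; apply/in_restriction.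
  have [j jB] := n0 B Bs; exists C; split=> //.
  by exists j; apply: (subsetP BC).
case/in_extension => [[C Cs ->]|[i _ ->]].
  have [D' /in_restriction[D [Dpi eD _]] CD] := h C Cs.
  by exists D => //; rewrite sub_imset_pre -eD.
by have [D Dpi iD] := cov i; exists D => //; rewrite sub1set.
Qed.

Lemma card_extension sigma :
  sigma \in Partitions J -> #|extension sigma| = #|sigma| + (#|I| - #|J|).
Proof.
case/PartitionsP => _ _ n0; rewrite /extension cardsU !card_imset; last 2 first.
- exact: set1_inj.
- exact: imset_inj.
rewrite [#|~: _|]cardsCs setCK card_imset //.
rewrite (_ : _ :&: _ = set0) ?cards0 ?subn0 //.
apply/eqP; rewrite -subset0; apply/subsetP => B; rewrite inE.
case/andP => /imsetP[C /n0[j jC] ->] /imsetP[i]; rewrite inE => ni e.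
suff ei : f j = i by rewrite -ei imset_f in ni.
by apply/eqP; rewrite -in_set1 -e imset_f.
Qed.

Lemma restriction_one_block : 0 < #|J| -> restriction one_block = one_block.
Proof.
move=> /card_gt0P[j _]; apply/setP => B; rewrite [RHS]inE.
apply/in_restriction/eqP.
  by case=> C [/set1P-> -> _]; rewrite preimsetT.
move=> ->; exists [set: I]; rewrite inE preimsetT; split=> //.
by exists j; rewrite inE.
Qed.

(** Each point outside [J] accounts for at most one lost block: the extension of
    the restriction of [pi] refines [pi], so it has at least as many blocks. *)
Lemma card_extension_restriction pi :
  pi \in Partitions I -> #|pi| <= #|restriction pi| + (#|I| - #|J|).
Proof.
move=> piP; have qP := restriction_Partitions piP.
rewrite -card_extension //; apply: card_refines => //.
  exact: extension_Partitions.
by rewrite extension_refines // refines_refl.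
Qed.

Variables (T : {set {set {set I}}}) (T' : {set {set {set J}}}).
Hypotheses (TP : T \subset Partitions I) (T'P : T' \subset Partitions J).
Hypothesis restrictT : forall pi, pi \in T -> restriction pi \in T'.

(** For [pi0] the top, the coefficient of [(P_J)_rho] in the marginal of
    [T[P]]. *)
Definition fiber_mobius (pi0 : {set {set I}}) rho : int :=
  (\sum_(pi in T | restriction pi == rho) mobius T pi pi0)%R.

Lemma fiber_mobius_sum pi0 sigma : sigma \in T' ->
  (\sum_(rho in T' | refines sigma rho) fiber_mobius pi0 rho =
   \sum_(pi in T | refines sigma (restriction pi)) mobius T pi pi0)%R.
Proof.
move=> sT'; rewrite [RHS](partition_big restriction
  (fun rho => (rho \in T') && refines sigma rho)).
  apply: eq_bigr => rho /andP[rT' sr]; apply: eq_bigl => pi.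
  by case: eqP => [->|]; rewrite ?andbF // sr !andbT.
by move=> pi /andP[piT ->]; rewrite restrictT.
Qed.

Lemma fiber_mobius_sum_extension pi0 sigma :
  sigma \in T' -> extension sigma \in T -> pi0 \in T ->
  (\sum_(rho in T' | refines sigma rho) fiber_mobius pi0 rho =
   (extension sigma == pi0)%:R)%R.
Proof.
move=> sT' psT p0T; rewrite fiber_mobius_sum // -(mobius_sum_dual TP) //.
apply: eq_bigl => pi; case piT: (pi \in T) => //=.
by rewrite extension_refines ?(subsetP TP) ?(subsetP T'P).
Qed.

End Restriction.

(** * Lattices with bounded block size and number of blocks *)

Section Capped.
Variables (I : finType) (b S : nat).
Hypothesis I0 : 0 < #|I|.

(** The common form of the two families: [J k n] is [capped 'I_n k.-1 0] and
    [J3 S n] is [capped 'I_n 2 S]. *)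
Definition capped : {set {set {set I}}} :=
  [set pi in Partitions I | [forall B in pi, #|B| <= b] && (S <= #|pi|)]
    :|: [set one_block].

Lemma cappedP pi : reflect
  (pi = one_block \/
   [/\ pi \in Partitions I, forall B, B \in pi -> #|B| <= b & S <= #|pi|])
  (pi \in capped).
Proof.
rewrite in_setU in_set1 orbC; apply: (iffP predU1P) => -[->|]; [by left| |by left|].
  by rewrite inE => /and3P[p /forall_inP bp sp]; right.
by case=> p bp sp; right; rewrite inE p sp andbT; apply/forall_inP.
Qed.

Lemma capped_Partitions : capped \subset Partitions I.
Proof.
by apply/subsetP => pi /cappedP[->|[]] //; apply: one_block_Partitions.
Qed.

Lemma one_block_capped : one_block \in capped.
Proof. by apply/cappedP; left. Qed.

Lemma one_block_uncapped (pi : {set {set I}}) : b < #|I| ->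
  (forall B, B \in pi -> #|B| <= b) -> pi != one_block.
Proof.
move=> bI bpi; apply/eqP => e; have := bpi [set: I].
by rewrite e inE eqxx cardsT leqNgt bI => /(_ isT).
Qed.

Lemma capped_lower : 0 < b -> S <= #|I| -> lower_set capped.
Proof.
move=> b0 SI; split; [exact: capped_Partitions | | exact: one_block_capped |].
  apply/cappedP; right; split; first exact: discrete_Partitions.
    by move=> _ /imsetP[i _ ->]; rewrite cards1.
  by rewrite card_imset //; apply: set1_inj.
move=> w z /cappedP[->|[wP bw Sw] _ zP zw]; first by rewrite eqxx.
apply/cappedP; right; split=> //.
  move=> B /(refinesP _ _ zw)[C Cw BC].
  exact: leq_trans (subset_leq_card BC) (bw C Cw).
exact: leq_trans Sw (card_refines _ _ zw).
Qed.

Lemma capped_symmetric (s : {perm I}) :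
  [set permute_partition s pi | pi in capped] = capped.
Proof.
have p_inj : injective (@permute_partition I s).
  exact: imset_inj (imset_inj (@perm_inj _ s)).
have sT : [set s i | i in [set: I]] = [set: I].
  by apply/eqP; rewrite eqEcard subsetT card_imset //=; apply: perm_inj.
apply/eqP; rewrite eqEcard card_imset // leqnn andbT.
apply/subsetP => _ /imsetP[pi /cappedP[->|[piP bpi Spi]] ->]; apply/cappedP.
  by left; rewrite /permute_partition /one_block imset_set1 sT.
right; split.
- move: piP; rewrite !inE -(imset_partition _ _ (@perm_inj _ s)).
  by rewrite sT.
- by move=> _ /imsetP[B Bpi ->]; rewrite card_imset ?bpi //; apply: perm_inj.
- by rewrite card_imset //; apply: imset_inj; apply: perm_inj.
Qed.

(** The witness for the order is the image of [f] completed by singletons, which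
    has [#|I| - b + 1] blocks. *)
Lemma capped_order (f : 'I_b -> I) : injective f ->
  0 < b -> b < #|I| -> S + b <= #|I|.+1 -> lattice_order capped = b.+1.
Proof.
move=> f_inj b0 bI Sb; congr _.+1.
apply/eqP; rewrite eqn_leq; apply/andP; split.
  apply/bigmax_leqP => pi; rewrite in_setD1 => /andP[n1 /cappedP[e|[_ bpi _]]].
    by rewrite e eqxx in n1.
  exact/bigmax_leqP.
have oP : @one_block 'I_b \in Partitions 'I_b.
  by apply: one_block_Partitions; rewrite card_ord.
set pi := extension f one_block.
have bpi B : B \in pi -> #|B| <= b.
  case/in_extension => [[C _ ->]|[i _ ->]]; last by rewrite cards1.
  by rewrite card_imset // -[X in _ <= X]card_ord max_card.
have piT : pi \in capped :\ one_block.
  rewrite in_setD1 one_block_uncapped //=; apply/cappedP; right; split=> //.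
    exact: extension_Partitions.
  rewrite card_extension // cards1 card_ord; lia.
apply: leq_trans (leq_bigmax_cond _ piT).
have Bpi : f @: [set: 'I_b] \in pi.
  by apply/in_extension; left; exists [set: 'I_b]; rewrite ?inE.
apply: leq_trans (leq_bigmax_cond _ Bpi).
by rewrite card_imset // cardsT card_ord.
Qed.

End Capped.

Lemma capped_card (I : finType) (pi : {set {set I}}) b :
  pi \in Partitions I -> (forall B, B \in pi -> #|B| <= b) -> #|I| <= b * #|pi|.
Proof.
rewrite inE => /card_partition; rewrite cardsT => -> bpi.
by rewrite mulnC -sum_nat_const; apply: leq_sum.
Qed.

Lemma J_capped k n : J k n = capped _ k.-1 0.
Proof. by congr (_ :|: _); apply/setP => pi; rewrite !inE andbT. Qed.

(** * Removing one point *)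

Section PointRemoval.
Variables (I J : finType) (f : J -> I) (b S : nat).
Hypothesis f_inj : injective f.
Hypotheses (cardIJ : #|I| = #|J|.+1) (b0 : 0 < b) (bJ : b < #|J|) (S0 : 0 < S).

Let I0 : 0 < #|I|. Proof. by rewrite cardIJ. Qed.
Let J0 : 0 < #|J|. Proof. exact: leq_trans bJ. Qed.
Let bI : b < #|I|. Proof. by rewrite cardIJ ltnS ltnW. Qed.

Lemma capped_restriction pi :
  pi \in capped I b S -> restriction f pi \in capped J b S.-1.
Proof.
case/cappedP => [->|[piP bpi Spi]]; apply/cappedP; [left|right].
  exact: restriction_one_block.
split; first exact: restriction_Partitions.
  move=> B /in_restriction[C [Cpi -> _]]; apply: leq_trans (bpi _ Cpi).
  rewrite -(card_imset _ f_inj) subset_leq_card //.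
  by rewrite sub_imset_pre.
have := card_extension_restriction f_inj piP.
rewrite cardIJ subSn // subnn addn1 => le.
by rewrite -ltnS prednK //; apply: leq_trans le.
Qed.

Lemma capped_extension sigma :
  sigma \in capped J b S.-1 -> sigma != one_block ->
  extension f sigma \in capped I b S /\ extension f sigma != one_block.
Proof.
case/cappedP => [->|[sP bs Ss] _]; first by rewrite eqxx.
have bp B : B \in extension f sigma -> #|B| <= b.
  case/in_extension => [[C Cs ->]|[i _ ->]]; last by rewrite cards1.
  by rewrite card_imset ?bs.
split; last exact: one_block_uncapped bp.
apply/cappedP; right; split=> //; first exact: extension_Partitions.
by rewrite card_extension // cardIJ subSn // subnn addn1 -(prednK S0).
Qed.

(** By Moebius inversion in [capped J b S.-1] it suffices that the sum of
    [fiber_mobius] above [sigma] is 1 if [sigma] is the top and 0 otherwise. The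
    top has to be treated apart, since its extension has the block [J] of more
    than [b] points and so is not in [capped I b S]. *)
Lemma fiber_mobius_capped rho : rho \in capped J b S.-1 ->
  fiber_mobius f (capped I b S) one_block rho =
  mobius (capped J b S.-1) rho one_block.
Proof.
move=> rT'; have T'P := capped_Partitions b S.-1 J0.
have TP := capped_Partitions b S I0.
rewrite (mobius_inversion T'P _ rT') (bigD1 one_block) ?one_block_capped //=.
rewrite [X in (_ + X)%R]big1 ?addr0 => [|sigma /andP[sT' ns]]; last first.
  have [psT pn1] := capped_extension sT' ns.
  rewrite (fiber_mobius_sum_extension TP T'P capped_restriction)
    ?one_block_capped //.
  by rewrite (negPf pn1) mulr0.
rewrite (fiber_mobius_sum capped_restriction) ?one_block_capped //.
(* A partition into blocks of size at most b cannot restrict to the top,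
   because b < #|J|. *)
rewrite (big_pred1 one_block) ?mobiusE ?one_block_capped ?eqxx ?mulr1 //
  => pi /=.
apply/andP/eqP => [[piT le]|->]; last first.
  by rewrite one_block_capped restriction_one_block // refines_refl.
case/cappedP: (piT) => // -[piP bpi _].
have bp B : B \in restriction f pi -> #|B| <= b.
  case/in_restriction => C [Cpi -> _]; apply: leq_trans (bpi _ Cpi).
  by rewrite -(card_imset _ f_inj) subset_leq_card // sub_imset_pre.
have e := one_block_refines (restriction_Partitions f piP) J0 le.
by have := one_block_uncapped bJ bp; rewrite e eqxx.
Qed.
End PointRemoval.

Section Vanishing.
Variables (I J : finType) (f : J -> I) (T : {set {set {set I}}}).
Hypothesis TP : T \subset Partitions I.
Hypothesis oT : one_block \in T.
Hypothesis extendT : forall sigma, sigma \in Partitions J ->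
  extension f sigma \in T /\ extension f sigma != one_block.

(** When every extension stays in [T] below the top, the sums of
    [fiber_mobius] above any partition of [J] vanish; invert. *)
Lemma fiber_mobius_vanish rho : rho \in Partitions J ->
  fiber_mobius f T one_block rho = 0%R.
Proof.
move=> rP.
rewrite (mobius_inversion (subxx _) _ rP) big1 // => sigma sP.
have [psT pn1] := extendT sP.
rewrite (fiber_mobius_sum_extension TP (subxx _)) ?(negPf pn1) ?mulr0 //
  => pi piT.
by apply: restriction_Partitions; apply: (subsetP TP).
Qed.
End Vanishing.

(** * Product measures of a partition as mixtures of point masses *)

From mathcomp Require Import boolp classical_sets cardinality functions.
From mathcomp Require Import fsbigop reals numfun.
Local Open Scope ring_scope.

Section Kernel.
Variables (I L : finType).

(** Partitions presented by a labelling [c]; unlike blocks, labels can be shared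
    between a partition and its restriction. *)
Definition kernel_partition (c : I -> L) : {set {set I}} :=
  [set (c @^-1: [set l])%SET | l : L]%SET :\ finset.set0.

(** Labels that are not used have the empty fibre, which contributes 1; hence a
    product over blocks may be taken over all labels. *)
Lemma kernel_partition_prod (R : comPzRingType) (c : I -> L)
    (g : {set I} -> R) :
  g finset.set0 = 1 ->
  \prod_(B in kernel_partition c) g B = \prod_l g (c @^-1: [set l])%SET.
Proof.
move=> g0.
rewrite [RHS](bigID (fun l => (c @^-1: [set l])%SET == finset.set0)) /=.
rewrite [X in X * _]big1 ?mul1r => [|l /eqP-> //].
rewrite /kernel_partition.
have -> : [set (c @^-1: [set l])%SET | l : L]%SET :\ finset.set0 =
   [set (c @^-1: [set l])%SET | l in
     [pred l | (c @^-1: [set l])%SET != finset.set0]]%SET.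
  apply/setP => B; rewrite in_setD1.
  apply/andP/imsetP => [[B0 /imsetP[l _ eB]]|[l lP ->]].
    by exists l; rewrite ?inE -?eB.
  by split; [|rewrite imset_f].
rewrite big_imset // => l l' lP _ e.
have /set0Pn[i il] : (c @^-1: [set l])%SET != finset.set0 by exact: lP.
have := il; rewrite e !inE => /eqP <-; move: il; rewrite !inE => /eqP <- //.
Qed.

End Kernel.

Lemma pblock_kernel (I : finType) (pi : {set {set I}}) : pi \in Partitions I ->
  pi = kernel_partition (finset.pblock pi).
Proof.
move=> piP; have /PartitionsP[cov tr n0] := piP.
have trI : finset.trivIset pi by move: piP; rewrite inE => /and3P[].
have cP i : i \in finset.cover pi.
  by have [B Bpi iB] := cov i; apply/bigcupP; exists B.
have pre B : B \in pi -> (finset.pblock pi @^-1: [set B])%SET = B.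
  move=> Bpi; apply/setP => i; rewrite !inE; apply/eqP/idP => [<-|iB].
    by rewrite mem_pblock.
  exact: def_pblock.
apply/setP => B; rewrite in_setD1; apply/idP/andP => [Bpi|[B0 /imsetP[C _ eB]]].
  split; first by apply/set0Pn; apply: n0.
  by apply/imsetP; exists B; rewrite ?pre.
have /set0Pn[i] := B0; rewrite eB !inE => /eqP eC.
by rewrite -eC pre ?pblock_mem.
Qed.

(** In terms of labellings, restriction is composition. Since the set of labels
    does not change, the two sides of [reindex_partition_product] become sums
    over the same choices. *)
Lemma restriction_kernel (I J L : finType) (f : J -> I) (c : I -> L) :
  restriction f (kernel_partition c) = kernel_partition (c \o f).
Proof.
apply/setP => B; rewrite [RHS]in_setD1; apply/in_restriction/andP.
  case=> C [/setD1P[_ /imsetP[l _ ->]] -> [j jB]]; split.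
    by apply/set0Pn; exists j.
  by apply/imsetP; exists l => //; apply/setP => k; rewrite !inE.
case=> B0 /imsetP[l _ eB]; have /set0Pn[j jB] := B0.
exists (c @^-1: [set l])%SET; split.
- apply/setD1P; split; last by rewrite imset_f.
  by apply/set0Pn; exists (f j); move: jB; rewrite eB !inE.
- by rewrite eB; apply/setP => k; rewrite !inE.
- by exists j.
Qed.

Section Mixture.
Variables (R : realType) (I : finType) (X : I -> pointedType).
Variables (m : nat) (w : 'I_m -> R) (p : 'I_m -> forall i, X i).
Hypothesis w1 : \sum_k w k = 1.

Definition atomic (A : set (forall i, X i)) : R := \sum_k w k * \1_A (p k).

(** Distributing the product over labels of the marginal masses at [x] over the
    atoms of [P] gives a sum over all choices [h] of one atom per label; the
    summand is nonzero only if [x] agrees with [p (h l)] on the fibre of each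
    label [l], that is, only if [x] is the point glued from these pieces. *)
Lemma partition_product_atomic (L : finType) (c : I -> L) A :
  partition_product atomic (kernel_partition c) A =
  \sum_(h : {ffun L -> 'I_m})
     (\prod_l w (h l)) * \1_A (fun i => p (h (c i)) i).
Proof.
pose q (h : {ffun L -> 'I_m}) : forall i, X i := fun i => p (h (c i)) i.
have atom (x : forall i, X i) :
  \prod_(B in kernel_partition c)
     marginal B atomic [set (fun j : {i | i \in B} => x (val j))]%classic =
  \sum_(h : {ffun L -> 'I_m}) (\prod_l w (h l)) * (x == q h)%:R.
  (* The marginal on the empty block has mass 1, as the total mass is 1. *)
  rewrite kernel_partition_prod; last first.
    rewrite /marginal /reindex_measure /atomic -[RHS]w1; apply: eq_bigr => k _.
    rewrite indicE mem_set ?mulr1 //=; apply: functional_extensionality_dep.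
    by case=> i i0; have := i0; rewrite finset.in_set0.
  rewrite /marginal /reindex_measure /atomic bigA_distr_bigA /=.
  apply: eq_bigr => h _; rewrite big_split /=; congr (_ * _).
  case: eqP => [->|nx].
    rewrite big1 // => l _; rewrite indicE mem_set //=.
    apply: functional_extensionality_dep => -[i /= il].
    by move: (il); rewrite /q !inE => /eqP->.
  have [i ni] : exists i, x i <> q h i.
    apply: contrapT => h'; apply: nx; apply: functional_extensionality_dep => i.
    by apply: contrapT => ni; apply: h'; exists i.
  rewrite (bigD1 (c i)) //= indicE memNset ?mul0r //= => e.
  have ic : i \in (c @^-1: [set c i])%SET by rewrite !inE.
  pose B := (c @^-1: [set c i])%SET.
  have := congr1
    (fun g : forall j : {i | i \in B}, X (val j) => g (exist _ i ic)) e.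
  by move=> /esym.
(* All glued points lie in the finite set D, so the sum over A is a finite sum
   and can be exchanged with the sum over h. *)
pose D := [set q h | h in [set: {ffun L -> 'I_m}]]%classic.
have Dfin : finite_set D by apply: finite_image; apply: finite_finset.
have -> : partition_product atomic (kernel_partition c) A =
  \sum_(x \in A) \sum_(h : {ffun L -> 'I_m}) (\prod_l w (h l)) * (x == q h)%:R.
  by apply: eq_fsbigr => x _; apply: atom.
rewrite -(@fsbig_widen _ _ _ _ (A `&` D)%classic); first last.
- move=> x [Ax /= nAD]; apply: big1 => h _.
  case: eqP => [e|_]; last by rewrite mulr0.
  by case: nAD; split=> //; rewrite e; exists h.
- by move=> x [].
rewrite fsbig_finite; last exact: finite_setIr.
rewrite exchange_big /=; apply: eq_bigr => h _.
rewrite -mulr_sumr; congr (_ * _).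
rewrite -fsbig_finite; last exact: finite_setIr.
rewrite indicE; have [Aq|nAq] := boolP (q h \in A).
  rewrite (fsbigD1 (q h)) //=; first last.
  - by split; [apply: set_mem | exists h].
  - exact: finite_setIr.
  by rewrite eqxx fsbig1 ?addr0 // => x [_ /eqP/negPf ->].
by rewrite fsbig1 // => x [Ax _]; case: eqP => // e; rewrite -e mem_set in nAq.
Qed.
End Mixture.

Lemma discrete_probability_atomic (R : realType) (T : Type) (P : set T -> R) :
  discrete_probability P -> exists (m : nat) (w : 'I_m -> R) (p : 'I_m -> T),
    \sum_k w k = 1 /\ P = fun A => \sum_k w k * \1_A (p k).
Proof.
case=> -[s Ps] _ P1.
exists (size s), (fun k => (tnth (in_tuple s) k).1),
  (fun k => (tnth (in_tuple s) k).2).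
have PE : P = fun A => \sum_(k < size s)
    (tnth (in_tuple s) k).1 * \1_A (tnth (in_tuple s) k).2.
  by apply/funext => A; rewrite Ps big_tnth.
split=> //; rewrite -P1 PE; apply: eq_bigr => k _.
by rewrite indicE mem_set ?mulr1.
Qed.

Lemma reindex_partition_product (R : realType) (I J : finType)
    (X : I -> pointedType) (P : set (forall i, X i) -> R) (f : J -> I) pi :
  discrete_probability P -> pi \in Partitions I ->
  reindex_measure f (partition_product P pi) =
  partition_product (reindex_measure f P) (restriction f pi).
Proof.
move=> /discrete_probability_atomic[m [w [p [w1 ->]]]] piP.
have -> : pi = kernel_partition (finset.pblock pi) by apply: pblock_kernel.
apply/funext => A; rewrite restriction_kernel.
rewrite [LHS](partition_product_atomic p w1).
have -> : reindex_measure f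
     (fun B : set (forall i, X i) => \sum_k w k * \1_B (p k)) =
   atomic w (fun k j => p k (f j)).
  by [].
by rewrite partition_product_atomic.
Qed.

(** * Marginals of interactions *)

Lemma reindex_interaction (R : realType) (I J : finType)
    (X : I -> pointedType) (P : set (forall i, X i) -> R) (f : J -> I)
    (T : {set {set {set I}}}) (T' : {set {set {set J}}}) :
  discrete_probability P -> T \subset Partitions I ->
  (forall pi, pi \in T -> restriction f pi \in T') ->
  reindex_measure f (interaction T P) = fun A =>
  \sum_(rho in T') (fiber_mobius f T one_block rho)%:~R *
      partition_product (reindex_measure f P) rho A.
Proof.
move=> Pprob TP pT; apply/funext => A.
rewrite [LHS](partition_big (restriction f) (fun rho => rho \in T')) //=.
apply: eq_bigr => rho _; rewrite /fiber_mobius rmorph_sum mulr_suml /=.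
apply: eq_bigr => pi /andP[piT /eqP <-].
by rewrite -reindex_partition_product // (fintype.subsetP TP).
Qed.

Theorem corollary6p5 (R : realType) :
  ((forall k n : nat, (2 <= k)%N -> (k <= n)%N ->
      symmetric_partition_lattice (J k n) /\ lattice_order (J k n) = k) /\
   (forall S n : nat, (3 <= n)%N -> (uphalf n <= S)%N -> (S <= n.-1)%N ->
      symmetric_partition_lattice (J3 S n) /\ lattice_order (J3 S n) = 3%N)) /\
  ((forall (n S : nat) (X : 'I_n -> pointedType)
      (P : set (forall i, X i) -> R) (F : {set 'I_n}),
      (4 <= n)%N -> (uphalf n <= S)%N -> (S <= n.-1)%N ->
      discrete_probability P -> #|F| = n.-1 ->
      forall r : 'I_n.-1 -> {i | i \in F}, bijective r ->
        ((n < 2 * S)%N ->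
           reindex_measure r (marginal F (interaction (J3 S n) P)) =
           interaction (J3 S.-1 n.-1) (reindex_measure r (marginal F P)))
        /\
        ((2 * S)%N = n ->
           reindex_measure r (marginal F (interaction (J3 S n) P)) =
           interaction (J3 S n.-1) (reindex_measure r (marginal F P))))
   /\
   (forall (X : 'I_3 -> pointedType) (P : set (forall i, X i) -> R)
      (F : {set 'I_3}),
      discrete_probability P -> F != finset.set0 -> F \proper [set: 'I_3]%SET ->
      marginal F (interaction (J3 2 3) P) = (fun=> 0))).
Proof.
split; [split=> [k n k2 kn|S n n3 Sn nS] | split].
- have n0 : (0 < #|'I_n|)%N by rewrite card_ord; lia.
  rewrite J_capped; split.
    split; first by apply: capped_lower => //; lia.
    by move=> s; apply: capped_symmetric.
  have le : (k.-1 <= n)%N by lia.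
  rewrite (@capped_order _ _ _ n0 (widen_ord le)) ?card_ord; try lia.
  by move=> i j /(congr1 val) /= /val_inj.
- have n0 : (0 < #|'I_n|)%N by rewrite card_ord; lia.
  split.
    split; first by apply: (capped_lower n0) => //; rewrite card_ord; lia.
    by move=> s; apply: capped_symmetric.
  have le : (2 <= n)%N by lia.
  rewrite (@capped_order _ 2 S n0 (widen_ord le)) ?card_ord; try lia.
  by move=> i j /(congr1 val) /= /val_inj.
- move=> n S X P F n4 Sn nS Pprob cF r [r' rK r'K].
  pose f j := val (r j).
  have f_inj : injective f by move=> i j /val_inj /(can_inj rK).
  have main : reindex_measure r (marginal F (interaction (J3 S n) P)) =
     interaction (J3 S.-1 n.-1) (reindex_measure r (marginal F P)).
    have cIJ : #|'I_n| = #|'I_n.-1|.+1 by rewrite !card_ord; lia.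
    have bJ : (2 < #|'I_n.-1|)%N by rewrite card_ord; lia.
    have S0 : (0 < S)%N by lia.
    have n0 : (0 < #|'I_n|)%N by rewrite card_ord; lia.
    apply: etrans (reindex_interaction Pprob (capped_Partitions 2 S n0)
      (capped_restriction f_inj cIJ bJ S0)) _.
    apply/funext => A; apply: eq_bigr => rho rT'.
    by rewrite fiber_mobius_capped.
  split=> // nS2; rewrite main; suff -> : J3 S.-1 n.-1 = J3 S n.-1 by [].
  apply/setP => pi; apply/(cappedP 2)/(cappedP 2) => -[->|[piP b2 Sp]];
    try by left.
    right; split=> //; have := capped_card piP b2; rewrite card_ord; lia.
  by right; split=> //; lia.
- move=> X P F Pprob F0 Fprop.
  have cF : (0 < #|{: {i | i \in F}}| <= 2)%N.
    rewrite card_sig card_gt0 F0 /=.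
    by have := proper_card Fprop; rewrite cardsT card_ord.
  have I0 : (0 < #|'I_3|)%N by rewrite card_ord.
  have TP := capped_Partitions 2 2 I0.
  have f_inj : injective (val : {i | i \in F} -> 'I_3) by apply: val_inj.
  have [F1 F2] := andP cF.
  have extendT sigma : sigma \in Partitions {i | i \in F} ->
    extension val sigma \in J3 2 3 /\ extension val sigma != one_block.
    move=> sP.
    have bp B :
        B \in extension (val : {i | i \in F} -> 'I_3) sigma -> (#|B| <= 2)%N.
      case/in_extension => [[C Cs ->]|[i _ ->]]; last by rewrite cards1.
      by rewrite card_imset //; apply: leq_trans (max_card _) F2.
    split; last by apply: (one_block_uncapped _ bp); rewrite card_ord.
    apply/(cappedP 2); right; split=> //; first exact: extension_Partitions.
    rewrite card_extension // card_ord.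
    have : (0 < #|sigma|)%N.
      have /PartitionsP[cov _ _] := sP; have /card_gt0P[i _] := F1.
      by have [B Bs _] := cov i; apply/card_gt0P; exists B.
    by move=> s0; apply: (@leq_add 1 1) => //; rewrite subn_gt0.
  apply: etrans (reindex_interaction Pprob TP
    (fun pi h => restriction_Partitions val (fintype.subsetP TP pi h))) _.
  apply/funext => A; apply: big1 => rho rP.
  by rewrite (fiber_mobius_vanish TP (one_block_capped _ _ _)) ?mul0r.
Qed.
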